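(* Let $n\ge1$ and let $\lambda$ be a partition of $n$. Then the character of $\mathbb{C}^*$ on the tangent space to the Schubert cell $\mathrm{Sch}_\lambda$ at its fixed point $W_\lambda$ is $$ch(T_{W_\lambda}\mathrm{Sch}_\lambda)=\sum_{u\in\lambda}q^{-h_\lambda(u)},$$ where the sum is over the boxes $u$ of the Young diagram of $\lambda$ and $h_\lambda(u)$ is the hook length of $u$.
   Context: Let $\mathrm{Gr}(n)$ be the Grassmannian of $n$-dimensional subspaces of $\mathbb{C}[z]/(z^{2n})$, with the complete flag formed by the subspaces $(z^j)/(z^{2n})$. For a partition $\lambda=(l_1,\dots,l_n)$, $0\le l_1\le\dots\le l_n$, $l_1+\dots+l_n=n$, the Schubert cell $\mathrm{Sch}_\lambda\subset\mathrm{Gr}(n)$ is the set of $W$ whose nonzero elements have set of orders of vanishing at $z=0$ equal to $\{2n-l_i-i:1\le i\le n\}$. The group $\mathbb{C}^*$ acts on $\mathbb{C}[z]$ by $(c,z^i)\mapsto c^{-i}z^i$; the induced action on $\mathrm{Gr}(n)$ preserves $\mathrm{Sch}_\lambda$ and contracts it to the unique fixed point $W_\lambda=\langle z^{2n-l_1-1},z^{2n-l_2-2},\dots,z^{2n-l_n-n}\rangle$. The symbol $q^i$ denotes the character $c\mapsto c^i$ of $\mathbb{C}^*$, and $ch\,V=\sum_i\dim V_i\,q^i$ for a finite-dimensional $\mathbb{C}^*$-module $V$ with weight spaces $V_i$. *)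

(* Defs.v *)
From HB Require Import structures.
From mathcomp Require Import all_boot all_order all_algebra.
From mathcomp Require Import complex.
From mathcomp Require Import boolp classical_sets cardinality fsbigop reals.
From mathcomp Require Import mpoly.

Set Implicit Arguments.
Unset Strict Implicit.
Unset Printing Implicit Defensive.

Import GRing.Theory Num.Theory.

Local Open Scope classical_set_scope.
Local Open Scope ring_scope.

Section VspaceOfSet.
Variables (K : fieldType) (vT : vectType K).

Definition vspace_of_set (S : set vT) : {vspace vT} :=
  xget 0%VS [set U : {vspace vT} | forall v, (v \in U) <-> S v].

Lemma mem_vspace_of_set (S : set vT) :
  S 0 -> (forall a u v, S u -> S v -> S (a *: u + v)) ->
  forall v, (v \in vspace_of_set S) <-> S v.
Proof.
move=> S0 Slin.
suff: exists U : {vspace vT}, forall v, (v \in U) <-> S v by move/xgetPex; apply.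
pose P k := `[< exists U : {vspace vT}, \dim U = k /\ forall v, v \in U -> S v >].
have exP : exists k, P k.
  by exists 0%N; apply/asboolP; exists 0%VS; rewrite dimv0; split=> // v /[!memv0] /eqP->.
have leP k : P k -> (k <= \dim {:vT})%N.
  by move/asboolP=> [U [<- _]]; rewrite dimvS ?subvf.
case: (ex_maxnP exP leP) => k /asboolP[U [dimU US]] maxk.
exists U => v; split; first exact: US.
move=> Sv; have: P (\dim (<[v]> + U)%VS).
  apply/asboolP; exists (<[v]> + U)%VS; split=> // w /memv_addP[_ /vlineP[a ->]] [u Uu ->].
  exact: Slin (US _ Uu).
move/maxk; rewrite -dimU => le_dim.
have /eqP-> : U == (<[v]> + U)%VS by rewrite eqEdim addvSr.
by rewrite memvE addvSl.
Qed.

End VspaceOfSet.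

(* The Zariski tangent space at x of the locally closed subset X of the affine
   space vT: the common kernel of the differentials at x of the polynomial
   functions that vanish on X. *)
Section ZariskiTangent.
Variables (K : fieldType) (vT : vectType K).

Definition coords (v : vT) : 'I_(\dim {:vT}) -> K :=
  fun i => coord (vbasis {:vT}) i v.

Definition zariski_tangent (X : set vT) (x : vT) : {vspace vT} :=
  vspace_of_set [set v | forall p : {mpoly K[\dim {:vT}]},
    (forall y, X y -> p.@[coords y] = 0) ->
    \sum_i (p^`M(i)).@[coords x] * coords v i = 0].

Lemma mem_zariski_tangent (X : set vT) (x v : vT) :
  (v \in zariski_tangent X x) <-> forall p : {mpoly K[\dim {:vT}]},
    (forall y, X y -> p.@[coords y] = 0) ->
    \sum_i (p^`M(i)).@[coords x] * coords v i = 0.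
Proof.
apply: mem_vspace_of_set => [p _|a u w Tu Tw p pX].
  by rewrite big1 // => i _; rewrite /coords linear0 mulr0.
under eq_bigr do rewrite /coords linearP /= mulrDr mulrCA.
by rewrite big_split /= -mulr_sumr Tu // Tw // mulr0 addr0.
Qed.

End ZariskiTangent.

(* For a decomposition vT = W + W' (direct), T_W Gr = Hom(W, vT / W) is
   identified with Hom(W, W'), which is also the affine chart of Gr around W
   whose points are the graphs of the linear maps W -> W'; W is the graph of 0. *)
Section GrassmannianChart.
Variables (K : fieldType) (vT : vectType K) (W W' : {vspace vT}).

Definition chart (f : 'Hom(subvs_of W, subvs_of W')) : {vspace vT} :=
  limg (linfun vsval + (linfun vsval \o f))%VF.

Definition grass_tangent (X : set {vspace vT}) :
    {vspace 'Hom(subvs_of W, subvs_of W')} :=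
  zariski_tangent (chart @^-1` X) 0.

(* The differential at W of the action on Gr of an automorphism g of vT that
   preserves both W and W'. *)
Definition hom_act (g : 'End(vT)) (f : 'Hom(subvs_of W, subvs_of W')) :
    'Hom(subvs_of W, subvs_of W') :=
  (linfun (vsproj W') \o g \o linfun vsval \o f
     \o linfun (vsproj W) \o g^-1 \o linfun vsval)%VF.

(* In the chart, g acts by the linear map hom_act g, which is therefore its own
   differential. *)
Lemma chart_hom_act (g : 'End(vT)) f :
  lker g = 0%VS -> (g @: W <= W)%VS -> (g @: W' <= W')%VS ->
  chart (hom_act g f) = (g @: chart f)%VS.
Proof.
move=> /eqP g0 gW gW'.
have gVW w : w \in W -> (g^-1)%VF w \in W.
  have /eqP gWE : (g @: W)%VS == W.
    by rewrite eqEdim gW /= limg_dim_eq ?leqnn //; move: g0 => /eqP ->; apply: capv0.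
  by rewrite -{1}gWE => /memv_imgP[u Wu ->]; rewrite (lker0_lfunK g0).
have hE (w : subvs_of W) : vsval (hom_act g f w) =
    g (vsval (f (vsproj W ((g^-1)%VF (vsval w))))).
  rewrite /hom_act !comp_lfunE !(lfunE vsval) !(lfunE (vsproj _)) /= vsprojK //.
  exact/(subvP gW')/memv_img/subvsP.
have chE (h : 'Hom(subvs_of W, subvs_of W')) w :
    (linfun vsval + (linfun vsval \o h))%VF w = vsval w + vsval (h w).
  by rewrite add_lfunE comp_lfunE !(lfunE vsval).
apply/vspaceP=> v; apply/memv_imgP/memv_imgP => -[].
  move=> w _ ->; exists (vsval (vsproj W ((g^-1)%VF (vsval w))) +
      vsval (f (vsproj W ((g^-1)%VF (vsval w))))).
    apply/memv_imgP; exists (vsproj W ((g^-1)%VF (vsval w))); rewrite ?memvf ?chE //.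
  rewrite chE hE linearD /=; congr (_ + _).
  by rewrite vsprojK ?gVW ?subvsP // lker0_lfunVK.
move=> _ /memv_imgP[w _ ->] ->; exists (vsproj W (g (vsval w))); rewrite ?memvf //.
have gw : g (vsval w) \in W by apply/(subvP gW)/memv_img/subvsP.
rewrite !chE hE linearD /= vsprojK //; congr (_ + g (vsval _)).
by rewrite (lker0_lfunK g0) vsvalK.
Qed.

End GrassmannianChart.

(* Laurent polynomials in q are taken inside the field of rational functions. *)
Definition q : {fraction {poly int}} := tofrac ('X : {poly int}).

(* A C^*-module is a subspace U together with a family of linear maps act c,
   for c != 0. *)
Section Character.
Variables (K : fieldType) (vT : vectType K) (act : K -> vT -> vT).

Definition weight_space (U : {vspace vT}) (i : int) : {vspace vT} :=
  vspace_of_set [set v | v \in U /\ forall c, c != 0 -> act c v = c ^ i *: v].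

Lemma mem_weight_space (U : {vspace vT}) (i : int) v :
  (forall c, linear (act c)) ->
  (v \in weight_space U i) <->
    (v \in U /\ forall c, c != 0 -> act c v = c ^ i *: v).
Proof.
move=> act_lin; have act0 c : act c 0 = 0.
  by have := act_lin c (-1) 0 0; rewrite scaler0 addr0 scaleN1r addNr.
apply: mem_vspace_of_set => [|a u w [Uu wu] [Uw ww]].
  by split=> [|c _]; rewrite ?mem0v ?act0 ?scaler0.
split=> [|c c0]; first by rewrite memvD ?memvZ.
by rewrite act_lin wu // ww // scalerDr !scalerA mulrC.
Qed.

Definition ch (U : {vspace vT}) : {fraction {poly int}} :=
  \sum_(i \in [set: int]) q ^ i *+ \dim (weight_space U i).

End Character.

Section SchubertCell.
Variables (R : realType) (n : nat).

Definition trunc_poly : vectType R[i] := {poly %/ ('X^(2 * n) : {poly R[i]})}.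

(* The representative of degree < 2n; it is 0 only if p is, and has the same
   order of vanishing at 0 as p. *)
Definition repr_poly (p : trunc_poly) : {poly R[i]} :=
  (p : {poly %/ ('X^(2 * n) : {poly R[i]})}).

Definition zpow (k : nat) : trunc_poly :=
  qpolyX ('X^(2 * n) : {poly R[i]}) ^+ k.

Definition vanish_order (p : trunc_poly) : nat := mup 0 (repr_poly p).

(* The rows of the partition are indexed from 0 instead of 1. *)
Definition cell_order (l : n.-tuple nat) (i : 'I_n) : nat :=
  2 * n - tnth l i - i.+1.

Definition Sch (l : n.-tuple nat) : set {vspace trunc_poly} :=
  [set W | \dim W = n /\
    forall k : nat,
      (exists p : trunc_poly, [/\ p \in W, p != 0 & vanish_order p = k]) <->
      (exists i : 'I_n, k = cell_order l i)].

Definition Wfix (l : n.-tuple nat) : {vspace trunc_poly} :=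
  <<[seq zpow (cell_order l i) | i : 'I_n]>>%VS.

(* The C^*-stable complement of Wfix l. *)
Definition Wcompl (l : n.-tuple nat) : {vspace trunc_poly} :=
  <<[seq zpow k | k <- iota 0 (2 * n) &
       k \notin [seq cell_order l i | i : 'I_n]]>>%VS.

Definition Cstar_fun (c : R[i]) (p : trunc_poly) : trunc_poly :=
  in_qpoly ('X^(2 * n)) (repr_poly p \Po (c^-1 *: 'X)).

Definition Cstar (c : R[i]) : 'End(trunc_poly) := linfun (Cstar_fun c).

Fact Cstar_fun_linear c : linear (Cstar_fun c).
Proof.
by move=> a p p'; rewrite /Cstar_fun /= comp_polyD comp_polyZ in_qpolyD in_qpolyZ.
Qed.

HB.instance Definition _ c :=
  GRing.isLinear.Build R[i] trunc_poly trunc_poly *:%R (Cstar_fun c)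
    (Cstar_fun_linear c).

Lemma zpow_in_qpoly k : zpow k = in_qpoly ('X^(2 * n)) 'X^k.
Proof. by rewrite /zpow /qpolyX -rmorphXn. Qed.

Lemma repr_zpow k : (k < 2 * n)%N -> repr_poly (zpow k) = 'X^k.
Proof.
move=> lt_k; rewrite zpow_in_qpoly /repr_poly in_qpoly_small //.
by rewrite mk_monic_Xn !size_polyXn prednK // (leq_trans _ lt_k).
Qed.

Lemma size_repr_poly (p : trunc_poly) :
  (0 < n)%N -> (size (repr_poly p) <= 2 * n)%N.
Proof.
move=> n_gt0; apply: leq_trans (size_npoly _) _.
by rewrite mk_monic_Xn size_polyXn prednK // muln_gt0.
Qed.

Lemma trunc_polyE (p : trunc_poly) : (0 < n)%N ->
  p = \sum_(i < 2 * n) (repr_poly p)`_i *: zpow i.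
Proof.
move=> n_gt0; have szp := size_repr_poly p n_gt0.
under eq_bigr do rewrite zpow_in_qpoly -in_qpolyZ.
rewrite -(raddf_sum (in_qpoly ('X^(2 * n) : {poly R[i]}))) /=.
rewrite -(poly_def (2 * n) (fun i => (repr_poly p)`_i)).
rewrite -/(take_poly (2 * n) (repr_poly p)) take_poly_id //.
apply/val_inj; rewrite /= Pdiv.Ring.rmodp_small //.
by rewrite mk_monic_Xn size_polyXn ltnS (leq_trans szp) // leqSpred.
Qed.

Lemma Cstar_zpow c k : (k < 2 * n)%N -> Cstar c (zpow k) = c ^- k *: zpow k.
Proof.
move=> lt_k; rewrite /Cstar lfunE /= /Cstar_fun repr_zpow //.
by rewrite comp_Xn_poly exprZn in_qpolyZ -zpow_in_qpoly exprVn.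
Qed.

Lemma Cstar_lker c : (0 < n)%N -> c != 0 -> lker (Cstar c) = 0%VS.
Proof.
move=> n_gt0 c0; apply/eqP/lker0P; apply: (@can_inj _ _ _ (Cstar c^-1)) => p.
rewrite {1}(trunc_polyE p n_gt0) !linear_sum [RHS](trunc_polyE p n_gt0) /=.
apply: eq_bigr => i _; rewrite !linearZ /= Cstar_zpow // linearZ /= Cstar_zpow //.
by congr (_ *: _); rewrite exprVn invrK scalerA mulVf ?expf_neq0 // scale1r.
Qed.

Lemma Cstar_stable c (s : seq nat) : (forall k, k \in s -> (k < 2 * n)%N) ->
  (Cstar c @: <<[seq zpow k | k <- s]>> <= <<[seq zpow k | k <- s]>>)%VS.
Proof.
move=> lts; rewrite limg_span; apply/span_subvP => _ /mapP[_ /mapP[k sk ->] ->].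
by rewrite Cstar_zpow ?lts // memvZ // memv_span // map_f.
Qed.

Lemma cell_order_lt (l : n.-tuple nat) i : (cell_order l i < 2 * n)%N.
Proof.
have n_gt0 : (0 < n)%N by apply: leq_ltn_trans (ltn_ord i).
by rewrite /cell_order -subnDA ltn_subrL addnS muln_gt0 n_gt0.
Qed.

Lemma Wfix_Wcompl (l : n.-tuple nat) : (0 < n)%N -> (Wfix l + Wcompl l = fullv)%VS.
Proof.
move=> n_gt0; apply/eqP; rewrite eqEsubv subvf; apply/subvP => p _.
rewrite (trunc_polyE p n_gt0) memv_suml // => k _; apply: memvZ.
have [kS|nk] := boolP (val k \in [seq cell_order l i | i : 'I_n]).
  have [i _ ->] := fintype.imageP kS.
  by apply/(subvP (addvSl _ _))/memv_span/fintype.image_f.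
by apply/(subvP (addvSr _ _))/memv_span/map_f; rewrite mem_filter nk mem_iota /=.
Qed.

Definition Cstar_tangent (l : n.-tuple nat) (c : R[i]) :
    'Hom(subvs_of (Wfix l), subvs_of (Wcompl l)) ->
    'Hom(subvs_of (Wfix l), subvs_of (Wcompl l)) :=
  hom_act (Cstar c).

Lemma chart_Cstar_tangent (l : n.-tuple nat) c f : (0 < n)%N -> c != 0 ->
  chart (Cstar_tangent c f) = (Cstar c @: chart (f : 'Hom(subvs_of (Wfix l), _)))%VS.
Proof.
move=> n_gt0 c0; apply: chart_hom_act; first exact: Cstar_lker.
  rewrite /Wfix /image_mem (map_comp zpow).
  by apply: Cstar_stable => _ /fintype.imageP[i _ ->]; apply: cell_order_lt.
by apply: Cstar_stable => k; rewrite mem_filter mem_iota => /andP[].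
Qed.

Definition Tan_Sch (l : n.-tuple nat) :
    {vspace 'Hom(subvs_of (Wfix l), subvs_of (Wcompl l))} :=
  grass_tangent (Wfix l) (Wcompl l) (Sch l).

Definition young (l : n.-tuple nat) : {set 'I_n * 'I_n} :=
  [set u : 'I_n * 'I_n | (u.2 < tnth l u.1)%N]%SET.

(* The parts are listed in increasing order, so the rows weakly below row i in
   the diagram (in English convention) are those of index at most i. *)
Definition hook (l : n.-tuple nat) (u : 'I_n * 'I_n) : {set 'I_n * 'I_n} :=
  [set v in young l | ((v.1 == u.1) && (u.2 <= v.2)%N)
                   || ((v.2 == u.2) && (v.1 <= u.1)%N)]%SET.

Definition hook_length (l : n.-tuple nat) (u : 'I_n * 'I_n) : nat :=
  #|hook l u|.

End SchubertCell.

(* Main.v *)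
Require Import Defs.
From HB Require Import structures.
From mathcomp Require Import all_boot all_order all_algebra.
From mathcomp Require Import complex.
From mathcomp Require Import boolp classical_sets cardinality fsbigop reals.
From mathcomp Require Import mpoly.
From mathcomp Require Import zify ring.

(* Let S be the set of cell orders and W' the span of the z^k with k outside S.
   In the chart Hom(W_lambda, W') the graph of g has all its orders of vanishing
   in S iff g(z^s) only involves z^k with k > s, for every s in S: the cell is a
   linear subspace of the chart, hence equal to its tangent space at 0, and it is
   spanned by the maps z^s |-> z^k with s in S, k not in S and s < k, of weight
   s - k.  With m_j the number of parts at most j, the integers outside S are
   k_j = 2n - 1 - j - m_j for 0 <= j < n, and s_i < k_j iff (i, j) is a box of the
   diagram; its hook length is then k_j - s_i. *)

Set Implicit Arguments.
Unset Strict Implicit.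
Unset Printing Implicit Defensive.

Import Order.TTheory GRing.Theory Num.Theory.

Local Open Scope ring_scope.

(** * Differentials along lines and the tangent space of a linear subspace *)

Section LineDerivative.
Variables (K : fieldType) (N : nat) (x v : 'I_N -> K).

Definition mline (p : {mpoly K[N]}) : {poly K} :=
  mmap polyC (fun i => (x i)%:P + v i *: 'X) p.

Lemma horner_mline p t : (mline p).[t] = p.@[fun i => x i + t * v i].
Proof.
rewrite /mline mevalE /mmap horner_sum; apply: eq_bigr => m _.
rewrite hornerM hornerC /mmap1 horner_prod; congr (_ * _).
by apply: eq_bigr => i _; rewrite horner_exp !hornerE mulrC.
Qed.

(** The chain rule. Both sides are additive in [p] and obey the same Leibniz rule at [x], so
    constants and variables suffice. *)
Lemma deriv_mline p : (mline p)^`().[0] = \sum_i (p^`M(i)).@[x] * v i.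
Proof.
have mline0 r : (mline r).[0] = r.@[x].
  by rewrite horner_mline; apply: meval_eq => i; rewrite mul0r addr0.
pose D r := (mline r)^`().[0] = \sum_i (r^`M(i)).@[x] * v i.
have DC c : D c%:MP.
  rewrite /D /mline mmapC derivC horner0 big1 // => i _.
  by rewrite mderivC meval0 mul0r.
have DM r s : D r -> D s -> D (r * s).
  rewrite /D => Dr Ds.
  have -> : mline (r * s) = mline r * mline s by rewrite /mline rmorphM.
  rewrite derivM hornerD !hornerM Dr Ds !mline0 mulr_suml mulr_sumr -big_split /=.
  by apply: eq_bigr => i _; rewrite mderivM mevalD !mevalM; ring.
have DD r s : D r -> D s -> D (r + s).
  rewrite /D => Dr Ds.
  have -> : mline (r + s) = mline r + mline s by rewrite /mline raddfD.
  rewrite derivD hornerD Dr Ds -big_split /=.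
  by apply: eq_bigr => i _; rewrite mderivD mevalD mulrDl.
have DX i : D 'X_i.
  rewrite /D /mline mmapX mmap1U derivD derivC derivZ derivX !hornerE.
  rewrite (bigD1 i) //= big1 => [|j ji]; rewrite mderivX mnm1E.
    rewrite eqxx scale1r mevalX big1 ?mul1r ?addr0 // => k _.
    by rewrite mnmBE subnn.
  by rewrite eq_sym (negPf ji) scale0r meval0 mul0r.
rewrite -/(D p); elim/mpolyind: p => [|c m p _ _ Dp]; first by rewrite -mpolyC0.
apply: DD Dp; rewrite -mul_mpolyC; apply: (DM) => //.
have D1 : D 1 by rewrite -mpolyC1.
rewrite mpolyXE_id; apply: (big_ind D) => // i _.
by elim: (m i) => [|k IH]; rewrite ?expr0 // exprS; apply: DM.
Qed.

End LineDerivative.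

(** In characteristic 0 the elements 0, ..., [size p] - 1 are distinct roots, more than the degree
    of a nonzero [p] allows. *)
Lemma poly_eq0_fun (K : numFieldType) (p : {poly K}) : (forall t, p.[t] = 0) -> p = 0.
Proof.
move=> p0; pose rs := [seq k%:R : K | k <- iota 0 (size p)].
apply: (@roots_geq_poly_eq0 _ _ rs); last by rewrite size_map size_iota.
  by apply/allP => t _; apply/rootP.
by rewrite map_inj_uniq ?iota_uniq // => a b /eqP; rewrite eqr_nat => /eqP.
Qed.

(** The linear forms that cut out U bound the tangent space by U. Conversely, a polynomial vanishing
    on U vanishes on the whole line through 0 and v in U, so its derivative along v is 0. *)
Lemma zariski_tangent_subspace (K : numFieldType) (vT : vectType K)
    (X : set vT) (U : {vspace vT}) :
  (forall y, X y <-> y \in U) -> zariski_tangent X 0 = U.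
Proof.
move=> XU; apply/vspaceP => v; apply/idP/idP.
  move=> /mem_zariski_tangent Tv.
  (* [g] is the projection along U onto a complement, so its kernel is U; the coordinates of [g] are
     the linear forms tested below. *)
  pose e i := (vbasis {:vT})`_i; pose g w := w - projv U w.
  pose c r (i : 'I_(\dim {:vT})) := coords (g (e i)) r.
  have cE r w : \sum_i c r i * coords w i = coords (g w) r.
    rewrite {2}(coord_vbasis (memvf w)) /g linear_sum /= -sumrB /coords linear_sum /=.
    by apply: eq_bigr => i _; rewrite linearZ /= -scalerBr linearZ /= mulrC.
  suff gv : g v = 0 by rewrite -[v](subrK (projv U v)) -/(g v) gv add0r memv_proj.
  rewrite (coord_vbasis (memvf (g v))) big1 // => r _.
  pose p : {mpoly K[\dim {:vT}]} := \sum_i c r i *: 'X_i.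
  have pE w : p.@[coords w] = coords (g w) r.
    rewrite -cE /p raddf_sum /=; apply: eq_bigr => i _.
    by rewrite mevalZ mevalXU.
  have dpE i : (p^`M(i)).@[coords 0] = c r i.
    rewrite /p (raddf_sum (mderiv i)) raddf_sum /= (bigD1 i) //= big1 => [|j ji].
      rewrite mderivZ mevalZ mderivX mnm1E eqxx scale1r mevalX big1 ?mulr1 ?addr0 //.
      by move=> k _; rewrite mnmBE subnn.
    by rewrite mderivZ mevalZ mderivX mnm1E (negPf ji) scale0r meval0 mulr0.
  rewrite -/(coords (g v) r) -cE; under eq_bigr do rewrite -dpE.
  rewrite Tv ?scale0r // => y /XU yU; rewrite pE /g projv_id // subrr.
  by rewrite /coords linear0.
move=> vU; apply/mem_zariski_tangent => p pX.
rewrite -deriv_mline; suff -> : mline (coords 0) (coords v) p = 0.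
  by rewrite deriv0 horner0.
apply: poly_eq0_fun => t; rewrite horner_mline -(pX (t *: v)); last exact/XU/memvZ.
by apply: meval_eq => i; rewrite /coords linear0 add0r linearZ.
Qed.

(** * Subspaces spanned by part of a basis, and their characters *)

Section DualBasis.
Variables (K : fieldType) (vT : vectType K) (I : finType).
Variables (E : I -> vT) (x : I -> {scalar vT}).
Hypothesis xE : forall i j, x i (E j) = (i == j)%:R.
Hypothesis decE : forall v, v = \sum_i x i v *: E i.

Definition coord_subspace (A : {pred I}) : {vspace vT} := <<[seq E i | i in A]>>%VS.

Lemma mem_coord_subspace (A : {pred I}) v :
  v \in coord_subspace A <-> forall i, i \notin A -> x i v = 0.
Proof.
split=> [vA i iA|v0]; last first.
  rewrite (decE v) memv_suml // => i _; have [iA|/v0->] := boolP (i \in A).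
    by rewrite memvZ // memv_span // fintype.image_f.
  by rewrite scale0r mem0v.
rewrite (@coord_span _ _ _ (in_tuple [seq E j | j in A]) v vA) linear_sum big1 // => k _.
have /fintype.imageP[j jA ->] := mem_nth 0 (ltn_ord k).
rewrite linearZ /= xE; case: eqP => [ij|_]; last by rewrite mulr0.
by rewrite ij jA in iA.
Qed.

Lemma dim_coord_subspace (A : {pred I}) : \dim (coord_subspace A) = #|A|.
Proof.
have /eqP-> : free [seq E i | i in A]; last by rewrite size_map -cardE.
have sz : size [seq E i | i in A] == #|A| by rewrite size_map -cardE.
apply/(@freeP _ _ _ (Tuple sz)) => k k0 i /=.
have nthE (j : 'I_#|A|) : [seq E i | i in A]`_j = E (enum_val j).
  by rewrite (nth_map (enum_val j)) ?[_`_j]/(nth _ _ _) -?cardE // -enum_val_nth.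
have := congr1 (x (enum_val i)) k0; rewrite linear0 linear_sum (bigD1 i) //= big1 => [|j ji].
  by rewrite linearZ /= nthE xE eqxx mulr1 addr0.
by rewrite linearZ /= nthE xE (inj_eq enum_val_inj) eq_sym (negPf ji) mulr0.
Qed.

End DualBasis.

(** Lets the single scalar c = 2 separate all weights. The powers are compared in the rationals,
    where the order is total. *)
Lemma exprz2_inj (K : numFieldType) (a b : int) : (2 : K) ^ a = 2 ^ b -> a = b.
Proof.
rewrite -(ratr_nat K 2) -!fmorphXz => /fmorph_inj.
exact: ieexprIz.
Qed.

(** The last hypothesis makes each [E i] a vector of weight [w i]. A weight space is then spanned by
    the [E i] of that weight, and the sum over weights regroups the sum over [A]. *)
Lemma ch_coord_subspace (K : numFieldType) (vT : vectType K) (I : finType)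
    (E : I -> vT) (x : I -> {scalar vT}) (act : K -> vT -> vT) (w : I -> int)
    (A : {set I}) :
  (forall i j, x i (E j) = (i == j)%:R) ->
  (forall v, v = \sum_i x i v *: E i) ->
  (forall c, linear (act c)) ->
  (forall c i v, c != 0 -> x i (act c v) = c ^ w i * x i v) ->
  ch act (coord_subspace E (mem A)) = \sum_(i in A) q ^ w i.
Proof.
move=> xE decE act_lin xact.
have wsE k : weight_space act (coord_subspace E (mem A)) k =
    coord_subspace E (mem [set i in A | w i == k]%SET).
  apply/vspaceP => v; apply/idP/idP.
    move=> /(mem_weight_space _ _ _ act_lin)[/(mem_coord_subspace xE decE) vA vk].
    apply/(mem_coord_subspace xE decE) => i; rewrite inE negb_and => /orP[/vA//|wk].
    have n2 : (2 : K) != 0 by rewrite pnatr_eq0.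
    have := congr1 (x i) (vk 2 n2); rewrite xact // linearZ /= => /eqP.
    rewrite -subr_eq0 -mulrBl mulf_eq0 subr_eq0 => /orP[/eqP/exprz2_inj/eqP|/eqP//].
    by rewrite (negPf wk).
  move=> /(mem_coord_subspace xE decE) v0.
  apply/(mem_weight_space _ _ _ act_lin); split=> [|c c0].
    by apply/(mem_coord_subspace xE decE) => i iA; apply: v0; rewrite inE (negPf iA).
  rewrite (decE (act c v)) {2}(decE v) scaler_sumr; apply: eq_bigr => i _.
  rewrite xact // scalerA; have [<-//|wk] := eqVneq (w i) k.
  by rewrite v0 ?mulr0 // inE (negPf wk) andbF.
(* The weights that occur, each listed once: outside [r] the weight spaces are 0, so the sum over
   all integers is finite. *)
pose r := undup [seq w i | i in A].
rewrite /ch (fsbigE r) ?undup_uniq //; last first.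
  move=> k _ kr; rewrite wsE (dim_coord_subspace xE) [X in _ *+ X]eq_card0 // => i.
  rewrite !inE; apply/andP => -[iA /eqP wk].
  by move: kr; rewrite mem_undup -wk fintype.image_f.
transitivity (\sum_(k <- r) \sum_(i in A | w i == k) q ^ w i).
  apply: eq_big => k; rewrite in_setT // wsE (dim_coord_subspace xE) -sumr_const => _.
  by apply: eq_big => [i|i]; rewrite inE // => /andP[_ /eqP->].
rewrite (exchange_big_dep (mem A)) /=; last by move=> k i _ /andP[].
apply: eq_bigr => i iA; rewrite iA.
have -> : \sum_(k <- r | w i == k) q ^ w i = \sum_(k <- [seq k <- r | k == w i]) q ^ w i.
  by rewrite big_filter; apply: eq_bigl => k; rewrite eq_sym.
rewrite filter_pred1_uniq ?undup_uniq ?big_seq1 //.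
by rewrite mem_undup fintype.image_f.
Qed.

(** * The chart of graphs W -> W' in matrix coordinates *)

Section GraphChart.
Variables (K : fieldType) (vT : vectType K) (I J : finType).
Variables (e : I -> vT) (f : J -> vT) (x : I -> {scalar vT}) (y : J -> {scalar vT}).
Hypothesis xe : forall i i', x i (e i') = (i == i')%:R.
Hypothesis xf : forall i j, x i (f j) = 0.
Hypothesis ye : forall j i, y j (e i) = 0.
Hypothesis yf : forall j j', y j (f j') = (j == j')%:R.
Hypothesis dec : forall v, v = \sum_i x i v *: e i + \sum_j y j v *: f j.

Variables W W' : {vspace vT}.
Hypothesis memW : forall v, v \in W <-> forall j, y j v = 0.
Hypothesis memW' : forall v, v \in W' <-> forall i, x i v = 0.

Local Notation homT := 'Hom(subvs_of W, subvs_of W').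

Let eW i : e i \in W. Proof. by apply/memW => j. Qed.
Let fW' j : f j \in W'. Proof. by apply/memW' => i. Qed.

(** The elementary matrix sending [e u.1] to [f u.2] and the other [e i] to 0; [hom_coord] below is
    the corresponding matrix entry. *)
Definition hom_basis_fun (u : I * J) (w : subvs_of W) : subvs_of W' :=
  x u.1 (vsval w) *: vsproj W' (f u.2).

Fact hom_basis_fun_linear u : linear (hom_basis_fun u).
Proof.
by move=> a w w'; rewrite /hom_basis_fun linearP scalerDl scalerA.
Qed.

HB.instance Definition _ u :=
  GRing.isLinear.Build K (subvs_of W) (subvs_of W') *:%R (hom_basis_fun u)
    (hom_basis_fun_linear u).

Definition hom_basis (u : I * J) : homT := linfun (hom_basis_fun u).

Definition hom_coord (u : I * J) (g : homT) : K :=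
  y u.2 (vsval (g (vsproj W (e u.1)))).

Fact hom_coord_linear u : scalar (hom_coord u).
Proof.
by move=> a g h; rewrite /hom_coord add_lfunE scale_lfunE linearP.
Qed.

HB.instance Definition _ u :=
  GRing.isLinear.Build K homT K *%R (hom_coord u) (hom_coord_linear u).

Lemma hom_coord_basis u u' : hom_coord u (hom_basis u') = (u == u')%:R.
Proof.
rewrite /hom_coord /hom_basis lfunE /= /hom_basis_fun vsprojK // xe.
rewrite linearZ /= vsprojK // yf -natrM mulnb eq_sym.
by case: u u' => [i j] [i' j']; rewrite xpair_eqE.
Qed.

Lemma coord_hom_app j (g : homT) w :
  y j (vsval (g w)) = \sum_i x i (vsval w) * hom_coord (i, j) g.
Proof.
have {1}-> : w = \sum_i x i (vsval w) *: vsproj W (e i).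
  apply: val_inj => /=; rewrite linear_sum /= [LHS]dec [X in _ + X]big1 => [|k _].
    by rewrite addr0; apply: eq_bigr => i _; rewrite vsprojK.
  by have /memW-> := subvsP w; rewrite scale0r.
rewrite linear_sum /= linear_sum /= linear_sum /=; apply: eq_bigr => i _.
by rewrite !linearZ.
Qed.

Lemma subvs_coord_inj (v v' : subvs_of W') :
  (forall j, y j (vsval v) = y j (vsval v')) -> v = v'.
Proof.
move=> vv'; apply: val_inj => /=; rewrite [LHS]dec [RHS]dec; congr (_ + _).
  apply: eq_bigr => i _; have /memW'-> := subvsP v.
  by have /memW'-> := subvsP v'.
by apply: eq_bigr => j _; rewrite vv'.
Qed.

Lemma hom_basis_sum g : g = \sum_u hom_coord u g *: hom_basis u.
Proof.
apply/lfunP => w; apply: subvs_coord_inj => j; rewrite !coord_hom_app.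
apply: eq_bigr => i _; congr (_ * _).
rewrite linear_sum (bigD1 (i, j)) //= big1 => [|u uij].
  by rewrite linearZ /= hom_coord_basis eqxx mulr1 addr0.
by rewrite linearZ /= hom_coord_basis eq_sym (negPf uij) mulr0.
Qed.

Lemma chart_fun (g : homT) w :
  (linfun vsval + (linfun vsval \o g))%VF w = vsval w + vsval (g w).
Proof. by rewrite add_lfunE comp_lfunE !(lfunE vsval). Qed.

(** The [x] see only the W-component of a vector and the [y] only its W'-component; on the graph the
    latter is the image under [g] of the former. *)
Lemma mem_chart (g : homT) v :
  v \in chart g <-> forall j, y j v = \sum_i x i v * hom_coord (i, j) g.
Proof.
split=> [/memv_imgP[w _ ->] j|yv].
  rewrite chart_fun linearD /=; have /memW-> := subvsP w; rewrite add0r coord_hom_app.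
  by apply: eq_bigr => i _; rewrite linearD /=; have /memW'-> := subvsP (g w); rewrite addr0.
pose w := vsproj W (\sum_i x i v *: e i).
have wE : vsval w = \sum_i x i v *: e i.
  by rewrite vsprojK // memv_suml // => i _; rewrite memvZ.
have xw i : x i (vsval w) = x i v.
  rewrite wE linear_sum (bigD1 i) //= big1 => [|k ki].
    by rewrite linearZ /= xe eqxx mulr1 addr0.
  by rewrite linearZ /= xe eq_sym (negPf ki) mulr0.
apply/memv_imgP; exists w; rewrite ?memvf // chart_fun {1}[v]dec -wE; congr (_ + _).
rewrite [RHS]dec [X in _ = X + _]big1 => [|i _].
  rewrite add0r; apply: eq_bigr => j _; rewrite yv coord_hom_app.
  by under [in RHS]eq_bigr do rewrite xw.
by have /memW'-> := subvsP (g w); rewrite scale0r.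
Qed.

(** The map w |-> w + g w is injective, because adding g w leaves the [x]-coordinates of w
    unchanged. *)
Lemma dim_chart (g : homT) : \dim (chart g) = \dim W.
Proof.
rewrite /chart limg_dim_eq ?dimvf //; apply/eqP; rewrite -subv0.
apply/subvP => w /memv_capP[_]; rewrite memv_ker chart_fun memv0 => /eqP w0.
apply/eqP/val_inj; rewrite /= [LHS]dec !big1 ?addr0 // => [j _|i _].
  by have /memW-> := subvsP w; rewrite scale0r.
have := congr1 (x i) w0; rewrite linearD linear0 /=.
by have /memW'-> := subvsP (g w); rewrite addr0 => ->; rewrite scale0r.
Qed.

(** The action is conjugation by a diagonal [a]: the inverse contributes the factor 1 / ci at the
    source, and [a] the factor cj at the target. *)
Lemma hom_coord_act (a : 'End(vT)) (ci : I -> K) (cj : J -> K) (g : homT) u :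
  lker a = 0%VS ->
  (forall i, ci i != 0) -> (forall i, a (e i) = ci i *: e i) ->
  (forall j, a (f j) = cj j *: f j) ->
  hom_coord u (hom_act a g) = cj u.2 / ci u.1 * hom_coord u g.
Proof.
move=> /eqP a0 ci0 ae af; case: u => i j; rewrite /hom_coord /hom_act /=.
(* This expansion also shows that [a] preserves W', so the projection onto W' inside [hom_act]
   changes nothing. *)
have aW' (v : subvs_of W') : a (vsval v) = \sum_k (y k (vsval v) * cj k) *: f k.
  rewrite {1}[vsval v]dec big1 ?add0r => [|k _].
    by rewrite linear_sum; apply: eq_bigr => k _; rewrite linearZ /= af scalerA.
  by have /memW'-> := subvsP v; rewrite scale0r.
have ya (v : subvs_of W') : y j (a (vsval v)) = cj j * y j (vsval v).
  rewrite aW' linear_sum (bigD1 j) //= big1 => [|k kj]; rewrite linearZ /= yf.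
    by rewrite eqxx mulr1 addr0 mulrC.
  by rewrite eq_sym (negPf kj) mulr0.
rewrite !comp_lfunE !(lfunE vsval) !(lfunE (vsproj _)) /= [vsval (vsproj W' _)]vsprojK; last first.
  by rewrite aW' memv_suml // => k _; rewrite memvZ.
rewrite vsprojK // ya.
have -> : (a^-1)%VF (e i) = (ci i)^-1 *: e i.
  by rewrite -{2}(lker0_lfunK a0 (e i)) ae linearZ scalerA mulVf // scale1r.
by rewrite !linearZ /= mulrA.
Qed.

End GraphChart.

Lemma hom_act_linear (K : fieldType) (vT : vectType K) (W W' : {vspace vT})
    (a : 'End(vT)) : linear (@hom_act K vT W W' a).
Proof.
move=> c g h; apply/lfunP => w; rewrite add_lfunE scale_lfunE /hom_act !comp_lfunE.
by rewrite add_lfunE scale_lfunE !linearP.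
Qed.

Lemma card_ord_itv n a b : (b <= n)%N -> #|[set k : 'I_n | (a <= k < b)%N]%SET| = (b - a)%N.
Proof.
move=> bn; rewrite -sum1dep_card.
by rewrite -(big_ord_widen_cond _ (fun k => a <= k)%N (fun=> 1)%N) //
  -(big_geq_mkord _ _ predT (fun=> 1)%N) sum_nat_const_nat muln1.
Qed.

(** * Orders in S, gaps of S, and hook lengths *)

Section Hooks.
Variables (n : nat) (l : n.-tuple nat).
(** The integer k_j. For sorted [l], [find (ltn j) l] is m_j, the index of the first part exceeding
    j; it defaults to n when there is none. *)
Definition gap_order (j : 'I_n) : nat := 2 * n - j - (find (ltn j) l).+1.

Lemma find_le (j : nat) : (find (ltn j) l <= n)%N.
Proof. by rewrite -{2}(size_tuple l) find_size. Qed.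

(** k_j strictly decreases in j, since m_j does not decrease; as j < n and m_j <= n, the
    subtractions never truncate. *)
Lemma gap_order_inj : injective gap_order.
Proof.
have lt (j j' : 'I_n) : (j < j')%N -> gap_order j != gap_order j'.
  move=> jj'; have : (find (ltn j) l <= find (ltn j') l)%N.
    by apply: sub_find => k /=; apply: ltn_trans.
  rewrite /gap_order; have := find_le j; have := find_le j'.
  by have := ltn_ord j; have := ltn_ord j'; lia.
move=> j j' jj'; apply/val_inj; case: (ltngtP j j') => // /lt; first by rewrite jj' eqxx.
by rewrite jj' eqxx.
Qed.

Lemma gap_order_lt j : (gap_order j < 2 * n)%N.
Proof. by rewrite /gap_order; have := ltn_ord j; lia. Qed.

Definition split_order (s : 'I_n + 'I_n) : 'I_(2 * n) :=
  match s with
  | inl i => Ordinal (cell_order_lt l i)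
  | inr j => Ordinal (gap_order_lt j)
  end.

Hypothesis l_sorted : sorted leq l.
Hypothesis l_le : forall i, (tnth l i <= n)%N.

(** In a sorted list the parts at most j form an initial segment, whose length is m_j. *)
Lemma ltn_find (j : nat) (i : 'I_n) : (i < find (ltn j) l)%N = (tnth l i <= j)%N.
Proof.
rewrite (tnth_nth 0%N); apply/idP/idP => [|lij].
  by move/(before_find 0%N)/negbT; rewrite /= -leqNgt.
rewrite ltnNge; apply/negP => find_le.
have hasj : has (ltn j) l by rewrite has_find size_tuple (leq_ltn_trans find_le).
have := nth_find 0%N hasj; rewrite /= ltnNge => /negP; apply.
apply: leq_trans lij; apply: (sorted_leq_nth leq_trans leqnn) => //;
  by rewrite inE size_tuple ?(leq_ltn_trans find_le).
Qed.

(** Here k_j - s_i = (l_i - j) + (i - m_j). By [ltn_find], either j < l_i and m_j <= i, or l_i <= j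
    and i < m_j: the difference is positive on boxes and negative elsewhere, never 0. *)
Lemma cell_gap_lt i j : (cell_order l i < gap_order j)%N = (j < tnth l i)%N.
Proof.
rewrite /cell_order /gap_order; have := ltn_find j i; have := find_le j.
by have := l_le i; have := ltn_ord i; have := ltn_ord j; lia.
Qed.

Lemma cell_gap_neq i j : cell_order l i != gap_order j.
Proof.
rewrite /cell_order /gap_order; have := ltn_find j i; have := find_le j.
by have := l_le i; have := ltn_ord i; have := ltn_ord j; lia.
Qed.

Lemma cell_order_inj : injective (cell_order l).
Proof.
have lt (i i' : 'I_n) : (i < i')%N -> cell_order l i != cell_order l i'.
  move=> ii'; have : (tnth l i <= tnth l i')%N.
    rewrite !(tnth_nth 0%N).
    by apply: (sorted_leq_nth leq_trans leqnn); rewrite ?inE ?size_tuple // ltnW.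
  rewrite /cell_order; have := l_le i; have := l_le i'.
  by have := ltn_ord i; have := ltn_ord i'; lia.
move=> i i' ii'; apply/val_inj; case: (ltngtP i i') => // /lt; first by rewrite ii' eqxx.
by rewrite ii' eqxx.
Qed.

(** The two families are injective and disjoint, and together have 2n members; hence the k_j are
    exactly the integers below 2n outside S. *)
Lemma split_order_bij : bijective split_order.
Proof.
apply: inj_card_bij; last by rewrite card_sum !card_ord addnn mul2n.
move=> [i|j] [i'|j'] /(congr1 val) /=.
- by move/cell_order_inj->.
- by move/eqP; rewrite (negPf (cell_gap_neq _ _)).
- by move/esym/eqP; rewrite (negPf (cell_gap_neq _ _)).
- by move/gap_order_inj->.
Qed.

Lemma cell_or_gap k : (k < 2 * n)%N ->
  (exists i, k = cell_order l i) \/ (exists j, k = gap_order j).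
Proof.
move=> lt_k; have [g _ gK] := split_order_bij.
have /(congr1 val) := gK (Ordinal lt_k).
by case: (g _) => [i|j] /= <-; [left; exists i | right; exists j].
Qed.

(** The arm together with the corner has l_i - j boxes and the leg has i - m_j; these add up to k_j
    - s_i. *)
Lemma hook_lengthE (i j : 'I_n) : (j < tnth l i)%N ->
  hook_length l (i, j) = (gap_order j - cell_order l i)%N.
Proof.
move=> ji; have := l_le i; have := find_le j => mn lin.
have mi : (find (ltn j) l <= i)%N by rewrite leqNgt ltn_find -ltnNge.
(* [A] is the arm with the corner box, [B] the leg without it: in column j the boxes are the rows of
   index at least m_j. *)
pose A := [set (i, k) | k in [set k : 'I_n | (j <= k < tnth l i)%N]]%SET.
pose B := [set (k, j) | k in [set k : 'I_n | (find (ltn j) l <= k < i)%N]]%SET.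
have inA a b : ((a, b) \in A) = (a == i) && (j <= b < tnth l i)%N.
  apply/imsetP/andP => [[k + [-> ->]]|[/eqP-> bP]]; first by rewrite inE.
  by exists b; rewrite ?inE.
have inB a b : ((a, b) \in B) = (b == j) && (find (ltn j) l <= a < i)%N.
  apply/imsetP/andP => [[k + [-> ->]]|[/eqP-> bP]]; first by rewrite inE.
  by exists a; rewrite ?inE.
have hookE : hook l (i, j) = (A :|: B)%SET.
  apply/setP => -[a b]; rewrite finset.in_setU inA inB !inE /=.
  have [->|ai] := eqVneq a i; have [->|bj] := eqVneq b j;
    rewrite ?ltnn ?andbF ?leqnn /= ?orbF ?orbT ?andbT ?andbF //.
    by rewrite andbC.
  (* The leg: (a, j) is a box iff m_j <= a, and the corner is excluded since a differs from i. *)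
  rewrite [(find _ _ <= a)%N]leqNgt ltn_find -ltnNge [(a < i)%N]ltn_neqAle; congr (_ && _).
  by rewrite -val_eqE in ai; rewrite ai.
have disj : [disjoint A & B].
  rewrite -finset.setI_eq0; apply/eqP/setP => -[a b]; rewrite finset.in_setI inA inB inE.
  by case: eqP => //= ->; rewrite ltnn !andbF.
rewrite /hook_length hookE cardsU (disjoint_setI0 disj) cards0 subn0.
rewrite !card_imset => [|a b []//|a b []//].
rewrite !card_ord_itv ?(ltnW (ltn_ord i)) // /gap_order /cell_order.
by have := ltn_ord i; have := ltn_ord j; lia.
Qed.

End Hooks.

Lemma dvdXn_coef (K : fieldType) (p : {poly K}) k :
  reflect (forall k', (k' < k)%N -> p`_k' = 0) ('X^k %| p).
Proof.
apply: (iffP idP) => [/dvdpP[r ->] k' ltk|p0]; first by rewrite coefMXn ltk.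
apply/dvdpP; exists (drop_poly k p); rewrite -[LHS](poly_take_drop k).
suff -> : take_poly k p = 0 by rewrite add0r.
by apply/polyP => k'; rewrite coef_take_poly coef0; case: ifP => // /p0.
Qed.

(** * The Schubert cell in the chart, its tangent space and the character *)

Section SchubertChart.
Variables (R : realType) (n : nat) (l : n.-tuple nat).
Hypothesis n_gt0 : (0 < n)%N.
Hypothesis l_sorted : sorted leq l.
Hypothesis l_le : forall i, (tnth l i <= n)%N.

Local Notation V := (trunc_poly R n).

Definition zcoef (k : nat) (p : V) : R[i] := (repr_poly p)`_k.

Fact zcoef_scalar k : scalar (zcoef k).
Proof. by move=> a p p'; rewrite /zcoef /repr_poly coefD coefZ. Qed.

HB.instance Definition _ k :=
  GRing.isLinear.Build R[i] V R[i] *%R (zcoef k) (zcoef_scalar k).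

Lemma zcoef_zpow k k' : (k' < 2 * n)%N -> zcoef k (zpow R n k') = (k == k')%:R.
Proof. by move=> lt_k'; rewrite /zcoef repr_zpow // coefXn. Qed.

Lemma zcoef_eq0 k p : (2 * n <= k)%N -> zcoef k p = 0.
Proof. by move=> le_k; rewrite /zcoef nth_default // (leq_trans (size_repr_poly p _)). Qed.

(** The multiplicity of the root 0 is at least m iff 'X^m divides; apply this with m = k and m = k +
    1. *)
Lemma vanish_orderP k (p : V) :
  (p != 0 /\ vanish_order p = k) <->
  (zcoef k p != 0 /\ forall k', (k' < k)%N -> zcoef k' p = 0).
Proof.
have geE m : p != 0 -> (m <= vanish_order p)%N = ('X^m %| repr_poly p).
  by move=> p0; rewrite /vanish_order mup_geq ?subr0.
split=> [[p0 ordk]|[pk pk']].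
  have := geE k p0; rewrite ordk leqnn => /esym/dvdXn_coef pk'; split=> //.
  apply/eqP => pk; have := geE k.+1 p0; rewrite ordk ltnn => /esym/negP; apply.
  by apply/dvdXn_coef => k'; rewrite ltnS leq_eqVlt => /predU1P[->|/pk'].
have p0 : p != 0 by apply: contraNneq pk => ->; rewrite linear0.
split=> //; apply/eqP; rewrite eqn_leq geE //; apply/andP; split; last exact/dvdXn_coef.
rewrite leqNgt geE //; apply/negP => /dvdXn_coef/(_ k (ltnSn k)) pk0.
by case/eqP: pk.
Qed.

(** Data for the abstract chart: the monomials with exponent in S and outside S, with their
    coefficient functionals as dual coordinates. *)
Let e (i : 'I_n) : V := zpow R n (cell_order l i).
Let f (j : 'I_n) : V := zpow R n (gap_order l j).
Let x (i : 'I_n) : {scalar V} := zcoef (cell_order l i).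
Let y (j : 'I_n) : {scalar V} := zcoef (gap_order l j).

Let xe i i' : x i (e i') = (i == i')%:R.
Proof.
by rewrite /x /e /= zcoef_zpow ?cell_order_lt // (inj_eq (cell_order_inj l_sorted l_le)).
Qed.

Let xf i j : x i (f j) = 0.
Proof.
by rewrite /x /f /= zcoef_zpow ?gap_order_lt // (negPf (cell_gap_neq l_sorted l_le i j)).
Qed.

Let ye j i : y j (e i) = 0.
Proof.
rewrite /y /e /= zcoef_zpow ?cell_order_lt // eq_sym.
by rewrite (negPf (cell_gap_neq l_sorted l_le i j)).
Qed.

Let yf j j' : y j (f j') = (j == j')%:R.
Proof.
by rewrite /y /f /= zcoef_zpow ?gap_order_lt // (inj_eq (gap_order_inj (l := l))).
Qed.

Let dec v : v = \sum_i x i v *: e i + \sum_j y j v *: f j.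
Proof.
rewrite {1}(trunc_polyE v n_gt0).
rewrite (reindex (split_order l)) /=; last exact/onW_bij/split_order_bij.
by rewrite big_sumType.
Qed.

Let memW v : v \in Wfix R l <-> forall j, y j v = 0.
Proof.
split=> [vW j|v0].
  rewrite (@coord_span _ _ _ (in_tuple _) v vW) linear_sum big1 // => k _.
  have /fintype.imageP[i _ ->] := mem_nth 0 (ltn_ord k).
  by rewrite linearZ /= ye mulr0.
rewrite (dec v) [X in _ + X]big1 => [|j _]; last by rewrite v0 scale0r.
by rewrite addr0 memv_suml // => i _; rewrite memvZ // memv_span // fintype.image_f.
Qed.

Let memW' v : v \in Wcompl R l <-> forall i, x i v = 0.
Proof.
split=> [vW i|v0].
  rewrite (@coord_span _ _ _ (in_tuple _) v vW) linear_sum big1 // => k _.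
  have /mapP[m + ->] := mem_nth 0 (ltn_ord k).
  rewrite mem_filter mem_iota => /andP[mS mn].
  rewrite linearZ /= zcoef_zpow //; case: eqP => [im|_]; last by rewrite mulr0.
  by case/negP: mS; rewrite -im fintype.image_f.
rewrite (dec v) big1 => [|i _]; last by rewrite v0 scale0r.
rewrite add0r memv_suml // => j _; apply/memvZ/memv_span/map_f.
rewrite mem_filter mem_iota gap_order_lt /= andbT; apply/negP => /fintype.imageP[i _ ij].
by have := cell_gap_neq l_sorted l_le i j; rewrite ij eqxx.
Qed.

Let dim_Wfix : \dim (Wfix R l) = n.
Proof.
by rewrite -[RHS]card_ord -(dim_coord_subspace xe).
Qed.

Local Notation homT := 'Hom(subvs_of (Wfix R l), subvs_of (Wcompl R l)).
Local Notation hc := (@hom_coord _ _ _ _ e y (Wfix R l) (Wcompl R l)).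
Local Notation hb := (@hom_basis _ _ _ _ f x (Wfix R l) (Wcompl R l)).

(** By [cell_gap_lt], the vanishing entries are those with k_j < s_i, so the condition says that g
    only raises orders. *)
Lemma chart_Sch (g : homT) :
  Sch l (chart g) <-> forall u, u \notin young l -> hc u g = 0.
Proof.
have mchart := mem_chart xe ye dec memW memW' g.
(* The point of the graph over [e i]. These vectors test both directions. *)
pose p i := e i + \sum_j hc (i, j) g *: f j.
have xp i i' : x i' (p i) = (i' == i)%:R.
  rewrite linearD linear_sum /= xe big1 ?addr0 // => j _.
  by rewrite linearZ /= xf mulr0.
have yp i j : y j (p i) = hc (i, j) g.
  rewrite linearD linear_sum /= ye add0r (bigD1 j) //= big1 => [|k kj].
    by rewrite linearZ /= yf eqxx mulr1 addr0.
  by rewrite linearZ /= yf eq_sym (negPf kj) mulr0.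
have pc i : p i \in chart g.
  apply/mchart => j; rewrite yp (bigD1 i) //= big1 => [|k ki].
    by rewrite xp eqxx mul1r addr0.
  by rewrite xp (negPf ki) mul0r.
split=> [[_ SchE] [i j]|g0].
  rewrite inE /= -(cell_gap_lt l_sorted l_le) -leqNgt leq_eqVlt eq_sym.
  rewrite (negPf (cell_gap_neq l_sorted l_le i j)) /= => ji.
  apply/eqP; apply: contraT => gij.
  have p0 : p i != 0.
    by apply: contraNneq gij => p0; rewrite -yp p0 linear0.
  have [i' ord_p] : exists i', vanish_order (p i) = cell_order l i'.
    by apply/SchE; exists (p i).
  have /vanish_orderP[pi' lt_p] := conj p0 ord_p.
  (* The only exponent of S occurring in [p i] is s_i, so its order must be s_i and its coefficient
     at the smaller k_j vanishes. *)
  have ii' : i' = i.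
    by apply/eqP; apply: contraNT pi' => ii'; rewrite -/(x i' (p i)) xp (negPf ii').
  by move: gij; rewrite -yp /y /= lt_p ?eqxx // ii'.
split; first by rewrite (dim_chart dec memW memW').
move=> k; split=> [[v [/mchart vg v0 ordv]]|[i ->]]; last first.
  exists (p i); suff /vanish_orderP[] : zcoef (cell_order l i) (p i) != 0 /\
      forall k', (k' < cell_order l i)%N -> zcoef k' (p i) = 0 by [].
  rewrite -/(x i (p i)) xp eqxx oner_eq0; split=> // k' k'i.
  have k'n : (k' < 2 * n)%N := ltn_trans k'i (cell_order_lt l i).
  have [[i' k'E]|[j k'E]] := cell_or_gap l_sorted l_le k'n; rewrite k'E.
    rewrite -/(x i' (p i)) xp; case: eqP => // ii'.
    by move: k'i; rewrite k'E ii' ltnn.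
  rewrite -/(y j (p i)) yp g0 // inE /= -(cell_gap_lt l_sorted l_le) -leqNgt.
  by rewrite -k'E ltnW.
have /vanish_orderP[vk lt_v] := conj v0 ordv.
have kn : (k < 2 * n)%N by rewrite ltnNge; apply: contraNN vk => /zcoef_eq0->.
have [//|[j kE]] := cell_or_gap l_sorted l_le kn.
(* Suppose v in the graph had order k_j. A nonzero entry (i, j) has s_i < k_j, where v has no
   coefficient; so the coefficient of v at k_j is 0 as well, a contradiction. *)
case/eqP: vk; rewrite kE -/(y j v) vg big1 // => i _.
have [uY|uY] := boolP ((i, j) \in young l); last by rewrite g0 ?mulr0.
move: uY; rewrite inE /= -(cell_gap_lt l_sorted l_le) -kE => /lt_v xv.
by rewrite /x /= xv mul0r.
Qed.

Let hcb u u' : hc u (hb u') = (u == u')%:R.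
Proof. exact: hom_coord_basis. Qed.

Let hbs g : g = \sum_u hc u g *: hb u.
Proof. exact: hom_basis_sum. Qed.

Lemma Tan_SchE : Tan_Sch R l = coord_subspace hb (mem (young l)).
Proof.
apply: zariski_tangent_subspace => g.
exact: iff_trans (chart_Sch g) (iff_sym (mem_coord_subspace hcb hbs _ _)).
Qed.

(** c scales z^k by c^-k, hence the entry (i, j) by c^(s_i - k_j); on a box this exponent is minus
    the hook length. *)
Lemma ch_Tan_Sch : ch (@Cstar_tangent R n l) (Tan_Sch R l) =
  \sum_(u in young l) q ^ (- (hook_length l u)%:Z).
Proof.
pose w (u : 'I_n * 'I_n) := (cell_order l u.1)%:Z - (gap_order l u.2)%:Z.
rewrite Tan_SchE (ch_coord_subspace (w := w) _ hcb hbs).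
- apply: eq_bigr => -[i j]; rewrite inE /= => ji; congr (_ ^ _).
  rewrite hook_lengthE // /w /=.
  by have := cell_gap_lt l_sorted l_le i j; rewrite ji; lia.
- by move=> c; apply: hom_act_linear.
move=> c u g c0.
pose ci (i : 'I_n) := c ^- cell_order l i; pose cj (j : 'I_n) := c ^- gap_order l j.
have ci0 i : ci i != 0 by rewrite invr_eq0 expf_neq0.
rewrite [LHS](hom_coord_act xf ye yf dec memW memW' (ci := ci) (cj := cj)) ?Cstar_lker //.
- congr (_ * _); rewrite /w /ci /cj expfzDr // mulrC invrK.
  by rewrite exprnP exprnN.
- by move=> i; rewrite Cstar_zpow ?cell_order_lt.
- by move=> j; rewrite Cstar_zpow ?gap_order_lt.
Qed.

End SchubertChart.

Lemma leq_mem_sumn (s : seq nat) a : a \in s -> (a <= sumn s)%N.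
Proof.
elim: s => //= b s IH; rewrite inE => /predU1P[->|/IH]; first exact: leq_addr.
by move/leq_trans; apply; apply: leq_addl.
Qed.

Theorem lemma3p2 (R : realType) (n : nat) (l : n.-tuple nat)
    (hn : (1 <= n)%N) (hsort : sorted leq l) (hsum : sumn l = n) :
  ch (@Cstar_tangent R n l) (Tan_Sch R l) =
  \sum_(u in young l) q ^ (- (hook_length l u)%:Z).
Proof.
(* It remains to bound each part by n, which keeps the subtractions in [cell_order] from
   truncating. *)
apply: ch_Tan_Sch => // i.
by rewrite -[leqRHS]hsum leq_mem_sumn ?mem_tnth.
Qed.
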